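(* In Leibniz algebras (over $\mathbb{C}$), the following hold. (a) Not every product can be written as a linear combination of right normed products of the same elements: there exist a Leibniz algebra $A$ and a product (with some bracketing) of finitely many elements of $A$ which is not a linear combination of right normed products of the same elements. (b) If every right normed product of length $n$ is zero, this does not imply that the algebra is nilpotent: there exist a Leibniz algebra $A$ and a positive integer $n$ such that every right normed product of $n$ elements of $A$ is zero, but $A$ is not nilpotent. (c) If all right multiplications are nilpotent, this does not imply that the algebra is nilpotent: there exists a Leibniz algebra $A$ such that for every $x \in A$ the right multiplication $R_x : A \to A$, $R_x(t) = tx$, is a nilpotent linear map, but $A$ is not nilpotent.
   Context: A Leibniz algebra over $\mathbb{C}$ is a vector space $A$ with a bilinear product satisfying $x(yz) = (xy)z + y(xz)$ for all $x,y,z \in A$ (so left multiplications are derivations). A product is left normed if it has the form $x_n(x_{n-1}(\cdots(x_3(x_2x_1))\cdots))$. A product is right normed if it has the mirror-image form $((\cdots((x_1x_2)x_3)\cdots)x_{n-1})x_n$; its length is $n$. ''Right normed products of the same elements'' means right normed products in which the same elements (with the same multiplicities) appear, in any order. A Leibniz algebra $A$ is nilpotent if its lower central series $A^1 = A$, $A^{k+1} = A A^k$ (the span of products $xy$ with $x \in A$, $y \in A^k$) reaches $0$. *)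

(* Defs.v *)
From HB Require Import structures.
From mathcomp Require Import all_boot all_order all_algebra.
From mathcomp Require Import sesquilinear.
From mathcomp Require Import classical_sets reals.
From mathcomp.real_closed Require Import complex.

Set Implicit Arguments.
Unset Strict Implicit.
Unset Printing Implicit Defensive.

Import Order.TTheory GRing.Theory Num.Theory.

Local Open Scope classical_set_scope.
Local Open Scope ring_scope.

(* No finiteness condition on the dimension. *)
Record leibnizAlgebra (K : fieldType) := LeibnizAlgebra {
  leibniz_sort :> lmodType K;
  lmul : {bilinear leibniz_sort -> leibniz_sort -> leibniz_sort};
  lmul_leibniz : forall x y z : leibniz_sort,
    lmul x (lmul y z) = lmul (lmul x y) z + lmul y (lmul x z) }.

Arguments lmul {K l}.

Definition lin_span (K : fieldType) (V : lmodType K) (S : set V) : set V :=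
  [set v | exists (n : nat) (c : 'I_n -> K) (u : 'I_n -> V),
     (forall i, S (u i)) /\ v = \sum_(i < n) c i *: u i].

Section Products.
Variables (K : fieldType) (A : leibnizAlgebra K).

Inductive bracketing : Type :=
| Factor of A
| Bracket of bracketing & bracketing.

Fixpoint factors (w : bracketing) : seq A :=
  match w with
  | Factor x => [:: x]
  | Bracket u v => factors u ++ factors v
  end.

Fixpoint product (w : bracketing) : A :=
  match w with
  | Factor x => x
  | Bracket u v => lmul (product u) (product v)
  end.

(* right_normed [:: x1; ...; xn] is ((...((x1 x2) x3)...) x(n-1)) xn.
   The value on the empty sequence is junk. *)
Definition right_normed (s : seq A) : A :=
  if s is x :: s' then foldl (fun a b => lmul a b) x s' else 0.

(* The right normed products of the elements of s, taken with their
   multiplicities, in any order. *)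
Definition right_normed_products (s : seq A) : set A :=
  [set p | exists2 t : seq A, perm_eq t s & p = right_normed t].

Definition set_product (B C : set A) : set A :=
  lin_span [set p | exists x y, [/\ B x, C y & p = lmul x y]].

(* Indexed from 1: lower_central 1 is the whole of A
   (and so is the unused lower_central 0). *)
Definition lower_central (k : nat) : set A :=
  iter k.-1 (set_product setT) setT.

Definition nilpotent_algebra : Prop :=
  exists2 k : nat, (0 < k)%N & lower_central k = [set 0].

Definition right_mul (x : A) : A -> A := fun t => lmul t x.

Definition nilpotent_map (f : A -> A) : Prop :=
  exists m : nat, forall t : A, iter m f t = 0.

End Products.

Arguments nilpotent_algebra {K} A.

(* Main.v *)
Require Import Defs.
From HB Require Import structures.
From mathcomp Require Import all_boot all_order all_algebra.
From mathcomp Require Import sesquilinear.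
From mathcomp Require Import classical_sets reals.
From mathcomp.real_closed Require Import complex.

(** All three counterexamples are one two-dimensional algebra, spanned by [x]
    and [m], whose only nonzero product of basis vectors is [x m = m].  Left
    multiplication by [x] fixes [m], so [m = x (x m)] lies in every term of the
    lower central series; but every product [(a b) c] vanishes. *)

Set Implicit Arguments.
Unset Strict Implicit.
Unset Printing Implicit Defensive.

Import Order.TTheory GRing.Theory Num.Theory.

Local Open Scope classical_set_scope.
Local Open Scope ring_scope.

Section LinearSpan.
Variables (K : fieldType) (V : lmodType K).

Lemma lin_span_incl (S : set V) (v : V) : S v -> lin_span S v.
Proof.
move=> Sv; exists 1%N, (fun=> 1), (fun=> v).
by rewrite big_ord1 scale1r.
Qed.

Lemma lin_span_eq0 (S : set V) (v : V) :
  (forall u, S u -> u = 0) -> lin_span S v -> v = 0.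
Proof.
move=> S0 [n [c [u [Su ->]]]]; apply: big1 => i _.
by rewrite (S0 _ (Su i)) scaler0.
Qed.

End LinearSpan.

Section LeibnizAlgebras.
Variables (K : fieldType) (A : leibnizAlgebra K).

Lemma lower_central_left_fixed (x m : A) (k : nat) :
  lmul x m = m -> lower_central k m.
Proof.
(* Induction on the iteration count [k.-1] rather than on [k], so the index [0] needs no separate
   case. *)
move=> xm; rewrite /lower_central; elim: k.-1 => [//|j IHj].
by rewrite iterS; apply: lin_span_incl; exists x, m.
Qed.

Lemma left_fixed_not_nilpotent (x m : A) :
  lmul x m = m -> m <> 0 -> ~ nilpotent_algebra A.
Proof.
move=> xm m_neq0 [k _ Ak0]; apply: m_neq0.
by have := lower_central_left_fixed k xm; rewrite Ak0.
Qed.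

(** With three factors, the right normed bracketing is exactly [(a b) c], in whatever order the
    factors come. *)
Lemma right_normed3_eq0 (s : seq A) :
  (forall a b c : A, lmul (lmul a b) c = 0) -> size s = 3 -> right_normed s = 0.
Proof. by move=> A0; case: s => [|a [|b [|c [|]]]] //= _; apply: A0. Qed.

End LeibnizAlgebras.

Section Counterexample.
Variable K : fieldType.

Local Notation V := (K^o * K^o)%type.

(** The pair [(a, b)] stands for [a x + b m]; expanding [(a x + b m)(c x + d m)] leaves only
    [a d m]. *)
Definition line_mul (p q : V) : V := (0, p.1 * q.2).

Lemma line_mul_bilinear : bilinear_for *:%R *:%R line_mul.
Proof.
split=> [q|p] a u v; rewrite /line_mul; apply/pair_equal_spec; split => /=.
- by rewrite scaler0 addr0.
- by rewrite mulrDl -scalerAl.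
- by rewrite scaler0 addr0.
- by rewrite mulrDr -scalerAr.
Qed.

HB.instance Definition _ :=
  bilinear_isBilinear.Build K V V V *:%R *:%R line_mul line_mul_bilinear.

(** The term [(x y) z] vanishes because [x y] has no first coordinate. What remains says that the
    left multiplications by [x] and [y] commute: they scale the second coordinate by [x.1] and
    [y.1]. *)
Lemma line_mul_leibniz (x y z : V) :
  line_mul x (line_mul y z) =
  line_mul (line_mul x y) z + line_mul y (line_mul x z).
Proof.
by apply/pair_equal_spec; split; rewrite /= ?addr0 // mul0r add0r mulrCA.
Qed.

Definition line_algebra : leibnizAlgebra K :=
  @LeibnizAlgebra K V line_mul line_mul_leibniz.

Definition line_x : line_algebra := (1, 0) : V.
Definition line_m : line_algebra := (0, 1) : V.

Lemma line_mul_xm : lmul line_x line_m = line_m.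
Proof. by apply/pair_equal_spec; split; rewrite //= mulr1. Qed.

Lemma line_m_neq0 : line_m <> 0.
Proof. by case=> /eqP; rewrite oner_eq0. Qed.

(** A left factor acts only through its first coordinate, which is zero for any product. *)
Lemma line_mul3_eq0 (a b c : line_algebra) : lmul (lmul a b) c = 0.
Proof. by apply/pair_equal_spec; split; rewrite //= mul0r. Qed.

End Counterexample.

Theorem theorem5 (R : realType) :
  [/\ exists (A : leibnizAlgebra R[i]) (w : bracketing A),
        ~ lin_span (right_normed_products (factors w)) (product w),
      exists (A : leibnizAlgebra R[i]) (n : nat),
        [/\ (0 < n)%N,
            forall s : n.-tuple A, right_normed s = 0
          & ~ nilpotent_algebra A]
    & exists A : leibnizAlgebra R[i],
        (forall x : A, nilpotent_map (right_mul x)) /\ ~ nilpotent_algebra A].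
Proof.
pose A := line_algebra R[i]; pose x : A := line_x R[i]; pose m : A := line_m R[i].
have A_not_nilp : ~ nilpotent_algebra A.
  exact: left_fixed_not_nilpotent (line_mul_xm _) (@line_m_neq0 _).
have rn0 (s : seq A) : size s = 3 -> right_normed s = 0.
  exact/right_normed3_eq0/line_mul3_eq0.
split; exists A.
(* The product [x (x m)] equals [m]. Any reordering of its three factors has right normed product
   zero, so their span is zero and cannot contain [m]. *)
- exists (Bracket (Factor x) (Bracket (Factor x) (Factor m))) => /= span_m.
  apply: (@line_m_neq0 R[i]); move: span_m.
  rewrite !line_mul_xm; apply: lin_span_eq0 => u [t /perm_size t3 ->].
  exact: rn0.
- by exists 3; split=> // s; apply: rn0; rewrite size_tuple.
(* Applying the right multiplication twice gives [(t x') x'], again of the vanishing form. *)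
- by split=> // x'; exists 2 => t; apply: line_mul3_eq0.
Qed.
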